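(* Let $\ell<0$ and let $F:\mathbb{R}^d\to\mathcal{CC}(\mathbb{R}^d)$ be an $\ell$-relaxed one-sided Lipschitz set-valued mapping. For $x,\bar y\in\mathbb{R}^d$ put $$G_F(x,\bar y)=\bigcup_{y\in F(x)}B\Big(x+\frac{1}{2\ell}(\bar y-y),\frac{1}{2|\ell|}\|\bar y-y\|\Big).$$ Then for any $x\in\mathbb{R}^d$ and any $\bar y\in\mathbb{R}^d$ we have $$G_F(x,\bar y)=\bigcup_{y\in\operatorname{ext}(F(x))\cap\operatorname{ext}(\operatorname{conv}(F(x)\cup\{\bar y\}))}B\Big(x+\frac{1}{2\ell}(\bar y-y),\frac{1}{2|\ell|}\|\bar y-y\|\Big).$$
   Context: $\mathbb{R}^d$ carries the Euclidean norm $\|\cdot\|$ and the canonical inner product $\langle\cdot,\cdot\rangle$. For $z\in\mathbb{R}^d$ and $r\ge 0$, $B(z,r)=\{x\in\mathbb{R}^d:\|x-z\|\le r\}$ is the closed ball. $\mathcal{CC}(\mathbb{R}^d)$ is the collection of all nonempty convex compact subsets of $\mathbb{R}^d$. $\operatorname{ext}(C)$ denotes the set of extreme points of a compact convex set $C$, and $\operatorname{conv}$ denotes the convex hull. For $\ell\in\mathbb{R}$, $F:\mathbb{R}^d\to\mathcal{CC}(\mathbb{R}^d)$ is $\ell$-relaxed one-sided Lipschitz if for any $x,x'\in\mathbb{R}^d$ and any $y\in F(x)$ there exists $y'\in F(x')$ such that $\langle y'-y,x'-x\rangle\le\ell\|x'-x\|^2$. *)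

(* Defs.v *)
From mathcomp Require Import all_boot all_order all_algebra.
From mathcomp Require Import all_classical all_reals all_analysis.

Set Implicit Arguments.
Unset Strict Implicit.
Unset Printing Implicit Defensive.

Import Order.TTheory GRing.Theory Num.Theory.
Import numFieldNormedType.Exports.

Local Open Scope classical_set_scope.
Local Open Scope ring_scope.

Definition dotv (R : realType) (d : nat) (u v : 'rV[R]_d) : R :=
  \sum_(i < d) u 0 i * v 0 i.

(* The library norm `|v| on 'rV[R]_d is the maximum norm, so the Euclidean
   norm and its closed balls are defined separately. *)
Definition enorm (R : realType) (d : nat) (v : 'rV[R]_d) : R :=
  Num.sqrt (dotv v v).

Definition cball (R : realType) (d : nat) (z : 'rV[R]_d) (r : R) :
    set 'rV[R]_d :=
  [set x | enorm (x - z) <= r].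

(* [compact] refers to the product topology of 'rV[R]_d, which is the topology
   of the Euclidean norm. *)
Definition CC (R : realType) (d : nat) (A : set 'rV[R]_d) : Prop :=
  [/\ A !=set0, @convex_set R 'rV[R]_d A & compact A].

Definition conv_hull (R : realType) (E : lmodType R) (A : set E) : set E :=
  @smallest E (@convex_set R E) A.

Definition ext (R : realType) (E : lmodType R) (C : set E) : set E :=
  [set x | C x /\
    forall (a b : E) (t : R), C a -> C b -> 0 < t < 1 ->
      x = t *: a + (1 - t) *: b -> a = x /\ b = x].

Definition relaxed_one_sided_lipschitz (R : realType) (d : nat) (l : R)
    (F : 'rV[R]_d -> set 'rV[R]_d) : Prop :=
  forall x x' y : 'rV[R]_d, F x y ->
    exists y' : 'rV[R]_d,
      F x' y' /\ dotv (y' - y) (x' - x) <= l * enorm (x' - x) ^+ 2.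

Definition GF (R : realType) (d : nat) (l : R)
    (F : 'rV[R]_d -> set 'rV[R]_d) (x ybar : 'rV[R]_d) : set 'rV[R]_d :=
  \bigcup_(y in F x)
    cball (x + (1 / (2 * l)) *: (ybar - y))
          (1 / (2 * `|l|) * enorm (ybar - y)).

(* Main.v *)
(* With u = z - x, a point z lies in the ball attached to y if and only if
   <ybar - y, u> <= l |u|^2, so raising <y, u> keeps z in the ball. Replace y by
   a point of F x that maximises <., u> and, among those maximisers, lies
   farthest from ybar. As <ybar, u> <= <y, u>, this point also maximises <., u>
   on conv(F x U {ybar}), and the face of maximisers there stays in the ball
   around ybar through the point; strict convexity of that ball makes the point
   extreme in the hull, hence in F x. *)
Require Import Defs.
From mathcomp Require Import all_boot all_order all_algebra.
From mathcomp Require Import all_classical all_reals all_analysis.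
From mathcomp Require Import ring lra.

Set Implicit Arguments.
Unset Strict Implicit.
Unset Printing Implicit Defensive.

Import Order.TTheory GRing.Theory Num.Theory.
Import numFieldNormedType.Exports.

Local Open Scope classical_set_scope.
Local Open Scope ring_scope.

Lemma dotvC (R : realType) (d : nat) (u v : 'rV[R]_d) : dotv u v = dotv v u.
Proof. by apply: eq_bigr => i _; rewrite mulrC. Qed.

Lemma dotvDl (R : realType) (d : nat) (u v w : 'rV[R]_d) :
  dotv (u + v) w = dotv u w + dotv v w.
Proof. by rewrite -big_split; apply: eq_bigr => i _; rewrite !mxE mulrDl. Qed.

Lemma dotvZl (R : realType) (d : nat) (c : R) (u w : 'rV[R]_d) :
  dotv (c *: u) w = c * dotv u w.
Proof. by rewrite mulr_sumr; apply: eq_bigr => i _; rewrite !mxE mulrA. Qed.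

Lemma dotvBl (R : realType) (d : nat) (u v w : 'rV[R]_d) :
  dotv (u - v) w = dotv u w - dotv v w.
Proof. by rewrite dotvDl -scaleN1r dotvZl mulN1r. Qed.

Lemma dotvDr (R : realType) (d : nat) (u v w : 'rV[R]_d) :
  dotv w (u + v) = dotv w u + dotv w v.
Proof. by rewrite dotvC dotvDl !(dotvC w). Qed.

Lemma dotvBr (R : realType) (d : nat) (u v w : 'rV[R]_d) :
  dotv w (u - v) = dotv w u - dotv w v.
Proof. by rewrite dotvC dotvBl !(dotvC w). Qed.

Lemma dotvZr (R : realType) (d : nat) (c : R) (u w : 'rV[R]_d) :
  dotv w (c *: u) = c * dotv w u.
Proof. by rewrite dotvC dotvZl dotvC. Qed.

Lemma dotvv_ge0 (R : realType) (d : nat) (u : 'rV[R]_d) : 0 <= dotv u u.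
Proof. by apply: sumr_ge0 => i _; rewrite -expr2 sqr_ge0. Qed.

Lemma dotvv_eq0 (R : realType) (d : nat) (u : 'rV[R]_d) :
  dotv u u = 0 -> u = 0.
Proof.
move=> /eqP; rewrite psumr_eq0 => [/allP u0|i _]; last by rewrite -expr2 sqr_ge0.
apply/rowP => i; rewrite mxE; apply/eqP.
by have := u0 i (mem_index_enum i); rewrite /= mulf_eq0 orbb.
Qed.

(** For 0 < t < 1 the subtracted last term expresses the strict convexity of the squared distance to
    [p]; it is what later forces [a = b]. *)
Lemma dotvv_conv (R : realType) (d : nat) (t : R) (p a b : 'rV[R]_d) :
  let c := t *: a + (1 - t) *: b in
  dotv (c - p) (c - p) = t * dotv (a - p) (a - p)
    + (1 - t) * dotv (b - p) (b - p) - t * (1 - t) * dotv (a - b) (a - b).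
Proof.
rewrite /= !(dotvBl, dotvBr, dotvDl, dotvDr, dotvZl, dotvZr).
rewrite (dotvC b a) (dotvC p a) (dotvC p b); ring.
Qed.

Lemma continuous_dotv (R : realType) (d : nat) (T : topologicalType)
    (f g : T -> 'rV[R]_d) :
  continuous f -> continuous g -> continuous (fun v => dotv (f v) (g v)).
Proof.
move=> cf cg v; apply: cvg_big => [|i _]; first exact: add_continuous.
apply: cvgM.
  exact: (continuous_comp (cf v) (@coord_continuous R _ _ 0 i (f v))).
exact: (continuous_comp (cg v) (@coord_continuous R _ _ 0 i (g v))).
Qed.

(** Squaring cancels |w|^2 / (4 l^2) on both sides. With u = z - x there remains |u|^2 <= <w, u> /
    l, and multiplying by the negative [l] reverses it. *)
Lemma cball_dotv (R : realType) (d : nat) (l : R) (x w z : 'rV[R]_d) :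
  l < 0 ->
  cball (x + (1 / (2 * l)) *: w) (1 / (2 * `|l|) * enorm w) z <->
  dotv w (z - x) <= l * dotv (z - x) (z - x).
Proof.
move=> l0; have ln0 : l != 0 by rewrite lt_eqF.
rewrite /cball /= /enorm opprD addrA; move: (z - x) => u.
have -> : 1 / (2 * `|l|) = `|1 / (2 * l)|.
  by rewrite normrM normrV ?unitfE ?mulf_neq0// normrM normr1 normr_nat.
rewrite -sqrtr_sqr -sqrtrM ?sqr_ge0// ler_sqrt; last first.
  by apply: mulr_ge0; [exact: sqr_ge0|exact: dotvv_ge0].
rewrite !(dotvBl, dotvBr, dotvZl, dotvZr) (dotvC u w).
set D := dotv w u; set U := dotv u u; set W := dotv w w.
rewrite -subr_ge0 -[dotv w u <= _]subr_ge0 -/D -/U.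
have -> : (1 / (2 * l)) ^+ 2 * W - (U - 1 / (2 * l) * D -
    (1 / (2 * l) * D - 1 / (2 * l) * (1 / (2 * l) * W))) = (- l)^-1 * (l * U - D).
  by field.
by rewrite pmulr_rge0// invr_gt0 oppr_gt0.
Qed.

(* The maximisers in [exists_ext] stay maximal on the convex hull because the
   lower sections of "linear function, then ball" in lexicographic order are
   convex; no description of the hull as a set of combinations is needed. *)
Lemma convex_lex (R : realType) (d : nat) (u p : 'rV[R]_d) (M r : R) :
  @convex_set R 'rV[R]_d
    [set a | dotv a u <= M /\ (dotv a u = M -> dotv (a - p) (a - p) <= r)].
Proof.
suff lexC (a b : 'rV[R]_d) (t : R) : 0 < t -> t < 1 ->
    dotv a u <= M /\ (dotv a u = M -> dotv (a - p) (a - p) <= r) ->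
    dotv b u <= M /\ (dotv b u = M -> dotv (b - p) (b - p) <= r) ->
    let c := t *: a + (1 - t) *: b in
    dotv c u <= M /\ (dotv c u = M -> dotv (c - p) (c - p) <= r).
  apply/convex_setW => a b; rewrite !inE => aS bS t t0 t1.
  by apply/mem_set; exact: lexC.
move=> t0 t1 [aM ar] [bM br] c.
have t1' : 0 < 1 - t by rewrite subr_gt0.
rewrite /c dotvDl !dotvZl; split=> [|cM]; first by nra.
(* Both values are at most [M] and both weights are positive, so an average equal to [M] forces
   equality at each endpoint. *)
have aE : dotv a u = M by nra.
have bE : dotv b u = M by nra.
rewrite dotvv_conv.
have := dotvv_ge0 (a - b); move: (ar aE) (br bE).
move: (dotv _ _) (dotv (b - p) _) (dotv (a - b) _) => A B D Ar Br D0.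
have : 0 <= t * (1 - t) * D by rewrite !mulr_ge0// ltW.
nra.
Qed.

Lemma exists_ext (R : realType) (d : nat) (K : set 'rV[R]_d)
    (u p y0 : 'rV[R]_d) :
  compact K -> K y0 -> dotv p u <= dotv y0 u ->
  exists y, [/\ ext K y, ext (conv_hull (K `|` [set p])) y
             & dotv y0 u <= dotv y u].
Proof.
move=> cK Ky0 pu.
have clin : continuous (fun v : 'rV[R]_d => dotv v u).
  by apply: continuous_dotv => v; [exact: cvg_id|exact: cst_continuous].
have csq : continuous (fun v : 'rV[R]_d => dotv (v - p) (v - p)).
  have csub : continuous (fun v : 'rV[R]_d => v - p).
    by move=> v; apply: continuousB; [exact: cvg_id|exact: cst_continuous].
  exact: continuous_dotv.
have [m mK mM] : exists2 c, c \in K & forall t, t \in K -> dotv t u <= dotv c u.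
  apply: compact_EVT_max => //; first by exists y0.
  exact: continuous_subspaceT.
pose M := dotv m u.
(* The maximisers form a closed part of the compact [K], so one of them is farthest from [p]. *)
have [y] : exists2 c, c \in K `&` [set v | dotv v u = M] & forall t,
    t \in K `&` [set v | dotv v u = M] ->
    dotv (t - p) (t - p) <= dotv (c - p) (c - p).
  apply: compact_EVT_max; last exact: continuous_subspaceT.
    by exists m; split=> //; exact: set_mem.
  apply: compact_closedI => //.
  exact: (proj1 (continuous_closedP _) clin _ (@closed_eq R M)).
rewrite inE => -[Ky /= yM] yr; exists y.
set C := conv_hull _.
have KC : K `<=` C by move=> v Kv; apply: sub_gen_smallest; left.
have hullP v : C v ->
    dotv v u <= M /\ (dotv v u = M -> dotv (v - p) (v - p) <= dotv (y - p) (y - p)).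
  move: v; apply: smallest_sub; first exact: convex_lex.
  move=> v [Kv|->] /=.
    split; first by apply: mM; rewrite inE.
    by move=> vM; apply: yr; rewrite inE.
  (* For [p] itself the linear bound comes from [pu], and its distance to [p] is 0. *)
  split; first by rewrite (le_trans pu)// mM// inE.
  by rewrite subrr -[X in dotv X _ <= _](scale0r p) dotvZl mul0r dotvv_ge0.
have extC : ext C y.
  split=> [|a b t /hullP[aM ar] /hullP[bM br] /andP[t0 t1] yE]; first exact: KC.
  have t1' : 0 < 1 - t by rewrite subr_gt0.
  have yuE : M = t * dotv a u + (1 - t) * dotv b u.
    by rewrite -yM yE dotvDl !dotvZl.
  have aE : dotv a u = M by nra.
  have bE : dotv b u = M by nra.
  have sqE : dotv (y - p) (y - p) = t * dotv (a - p) (a - p)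
    + (1 - t) * dotv (b - p) (b - p) - t * (1 - t) * dotv (a - b) (a - b).
    by rewrite {1 2}yE dotvv_conv.
  (* Neither [a] nor [b] is farther from [p] than [y], so [sqE] leaves t (1 - t) |a - b|^2 <= 0. *)
  have ab : a = b.
    apply/subr0_eq/dotvv_eq0; apply/eqP; rewrite eq_le dotvv_ge0 andbT.
    rewrite -(@pmulr_rle0 _ (t * (1 - t))) ?mulr_gt0//.
    by move: (ar aE) (br bE); nra.
  by rewrite yE ab -scalerDl subrKC scale1r.
split=> //.
(* Extremality in the hull passes to the subset [K], which contains [y]. *)
- split=> // a b t Ka Kb; case: extC => _; apply; exact: KC.
- by rewrite yM; apply: mM; rewrite inE.
Qed.

Theorem theorem11 (R : realType) (d : nat) (l : R)
    (F : 'rV[R]_d -> set 'rV[R]_d) :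
  l < 0 ->
  (forall x : 'rV[R]_d, CC (F x)) ->
  relaxed_one_sided_lipschitz l F ->
  forall x ybar : 'rV[R]_d,
    GF l F x ybar =
    \bigcup_(y in ext (F x) `&` ext (conv_hull (F x `|` [set ybar])))
      cball (x + (1 / (2 * l)) *: (ybar - y))
            (1 / (2 * `|l|) * enorm (ybar - y)).
Proof.
move=> l0 FCC _ x ybar; have [_ _ cF] := FCC x.
apply/seteqP; split=> z [y]; last by move=> [[Fy _] _] zy; exists y.
move=> Fy /(cball_dotv _ _ _ l0); rewrite (dotvBl ybar) => zy.
(* The sign of [l] turns [zy] into <ybar, u> <= <y, u> with u = z - x, as [exists_ext] requires. *)
have lu : l * dotv (z - x) (z - x) <= 0 by rewrite nmulr_rle0 ?dotvv_ge0.
have [|y' [extF extC yy']] := exists_ext (u := z - x) (p := ybar) cF Fy.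
  by rewrite -subr_le0 (le_trans zy).
exists y' => //; apply/cball_dotv => //; rewrite (dotvBl ybar).
by apply: (le_trans _ zy); rewrite lerD2l lerN2.
Qed.
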